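(* Let $\alpha\in(0,1)$ and let $\phi:[0,1]\to[0,\infty)$ be twice continuously differentiable on $(0,1]$ and such that there exist finite constants $W>0$, $c$, $c'$ with $$(2-\alpha)W p^{\alpha-2}+c'\le|\phi^{(2)}(p)|\le(2-\alpha)Wp^{\alpha-2}+c\qquad\text{for all }p\in(0,1].$$ Then for $k\ge3$, $$R^*(n,k;\phi)\gtrsim\frac{k^{2-2\alpha}}{n}.$$
   Context: For an integer $k\ge1$, $\mathcal{M}_k$ denotes the set of probability vectors $P=(p_1,\dots,p_k)$ on $\{1,\dots,k\}$; $\theta(P)=\sum_{i=1}^k\phi(p_i)$. With $N\sim\mathrm{Multinomial}(n,P)$ the histogram of $n$ i.i.d. samples from $P$, $R^*(n,k;\phi)=\inf_{\hat\theta}\sup_{P\in\mathcal{M}_k}\mathbb{E}[(\hat\theta(N)-\theta(P))^2]$, infimum over all real-valued estimators of the histogram. $a\gtrsim b$ means $a\ge Cb$ for a positive constant $C$ not depending on $n,k$ (possibly depending on $\phi,\alpha$). Differentiability at $1$ is one-sided. *)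

(* Defs.v *)
From HB Require Import structures.
From mathcomp Require Import all_boot all_order all_algebra.
From mathcomp Require Import all_classical all_reals all_analysis.
Set Implicit Arguments. Unset Strict Implicit. Unset Printing Implicit Defensive.
Import Order.TTheory GRing.Theory Num.Theory.
Local Open Scope classical_set_scope.
Local Open Scope ring_scope.

Section Defs.
Variable R : realType.

Definition has_deriv_on01 (f : R -> R) (x l : R) : Prop :=
  forall e : R, 0 < e -> exists d : R, 0 < d /\
    forall q : R, 0 < q <= 1 -> q != x -> `|q - x| < d ->
      `|(f q - f x) / (q - x) - l| < e.

Definition cont_on01 (f : R -> R) (x : R) : Prop :=
  forall e : R, 0 < e -> exists d : R, 0 < d /\
    forall q : R, 0 < q <= 1 -> `|q - x| < d -> `|f q - f x| < e.

Definition prob_vec (k : nat) (P : 'I_k -> R) : Prop :=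
  (forall i, 0 <= P i) /\ \sum_(i < k) P i = 1.

Definition theta (phi : R -> R) (k : nat) (P : 'I_k -> R) : R :=
  \sum_(i < k) phi (P i).

Definition multinom_pmf (n k : nat) (P : 'I_k -> R)
    (N : {ffun 'I_k -> 'I_n.+1}) : R :=
  if (\sum_(i < k) (N i : nat) == n)%N then
    (n`!)%:R / (\prod_(i < k) (N i)`!)%:R * \prod_(i < k) P i ^+ N i
  else 0.

Definition risk (n k : nat) (phi : R -> R)
    (est : {ffun 'I_k -> 'I_n.+1} -> R) (P : 'I_k -> R) : R :=
  \sum_(N : {ffun 'I_k -> 'I_n.+1})
     multinom_pmf P N * (est N - theta phi P) ^+ 2.

Definition minimax_risk (n k : nat) (phi : R -> R) : \bar R :=
  ereal_inf [set ereal_sup [set (risk phi est P)%:E | P in prob_vec (k:=k)]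
            | est in [set: {ffun 'I_k -> 'I_n.+1} -> R]].

End Defs.

(* Main.v *)
(** Le Cam's two-point method with P = (1 - a, a/m, ..., a/m), m = k - 1, and Q
    obtained from P by replacing a with a + a / sqrt n, for a fixed small a.
    The multinomial theorem makes the second moment of the likelihood ratio
    equal to (\sum_i Q_i^2 / P_i)^n <= (1 + 1/n)^n <= e.  Since phi'' has
    constant sign near 0 and is of order p^(alpha - 2), |phi'(p)| is at least of
    order p^(alpha - 1) near 0, while phi' is bounded near 1; hence
    a |-> phi(1 - a) + m phi(a/m) has derivative at least of order m^(1 - alpha)
    on a fixed interval, and theta(P), theta(Q) differ by at least a constant
    times k^(1 - alpha) / sqrt n. *)
Require Import Defs.
From HB Require Import structures.
From mathcomp Require Import all_boot all_order all_algebra.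
From mathcomp Require Import all_classical all_reals all_analysis.
From mathcomp Require Import ring lra.
Import Order.TTheory GRing.Theory Num.Theory.
Import numFieldNormedType.Exports.
Local Open Scope classical_set_scope.
Local Open Scope ring_scope.

(** * Multinomial sums and the two-point inequality *)

(** Coefficient form of exp(x_1 X) ... exp(x_k X) = exp((x_1 + ... + x_k) X); cutting each series
    after degree [m] leaves the coefficients of degree at most [m] intact. In the induction the
    Cauchy product is the binomial theorem. *)
Lemma coef_prod_truncated_exp (R : realType) (k m : nat) (x : 'I_k -> R) (n : nat) :
  (n <= m)%N ->
  (\prod_(i < k) \poly_(j < m.+1) (x i ^+ j / j`!%:R))`_n
    = (\sum_(i < k) x i) ^+ n / n`!%:R.
Proof.
elim: k x n => [|k IHk] x n lenm.
  rewrite !big_ord0 coef1; case: n lenm => [|n] _.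
    by rewrite eqxx expr0 fact0 invr1 mulr1.
  by rewrite expr0n mul0r.
rewrite !big_ord_recl coefM addrC exprDn mulr_suml; apply: eq_bigr => -[i /= ltin] _.
have lein : (i <= n)%N by rewrite -ltnS.
rewrite coef_poly ltnS (leq_trans lein lenm) IHk; last exact: leq_trans (leq_subr _ _) lenm.
have [fi fni] : i`!%:R != 0 :> R /\ (n - i)`!%:R != 0 :> R.
  by rewrite !pnatr_eq0 -!lt0n !fact_gt0.
have bin0 : 'C(n, i)%:R != 0 :> R by rewrite pnatr_eq0 -lt0n bin_gt0.
by rewrite -mulr_natr -(bin_fact lein) !natrM; field; rewrite fi fni bin0.
Qed.

(** The multinomial theorem, for arbitrary [x]: it is applied to [Q] and also to the vector of Q_i^2
    / P_i, which need not sum to 1. *)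
Lemma sum_multinom_pmf (R : realType) (n k : nat) (x : 'I_k -> R) :
  \sum_(N : {ffun 'I_k -> 'I_n.+1}) multinom_pmf x N = (\sum_(i < k) x i) ^+ n.
Proof.
have fn0 : n`!%:R != 0 :> R by rewrite pnatr_eq0 -lt0n fact_gt0.
have := @coef_prod_truncated_exp R k n x n (leqnn n).
under eq_bigr do rewrite poly_def.
(* Expanding the product of sums gives one monomial per histogram; the coefficient of degree [n]
   keeps those of total [n]. *)
rewrite bigA_distr_bigA coef_sum => /(congr1 (fun z => n`!%:R * z)).
rewrite mulrCA divff // mulr1 => <-; rewrite mulr_sumr; apply: eq_bigr => N _.
have -> : \prod_(i < k) ((x i ^+ N i / (N i)`!%:R) *: 'X^(N i) : {poly R})
    = (\prod_(i < k) (x i ^+ N i / (N i)`!%:R)) *: 'X^(\sum_(i < k) N i).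
  rewrite expr_sum -scaler_prod //.
rewrite coefZ coefXn /multinom_pmf eq_sym; case: eqP => _; last by rewrite !mulr0.
by rewrite mulr1 big_split /= prodfV natr_prod mulrAC mulrA.
Qed.

Lemma multinom_pmf_ge0 (R : realType) (n k : nat) (P : 'I_k -> R)
    (N : {ffun 'I_k -> 'I_n.+1}) :
  (forall i, 0 <= P i) -> 0 <= multinom_pmf P N.
Proof.
move=> P_ge0; rewrite /multinom_pmf; case: ifP => // _.
by rewrite mulr_ge0 ?divr_ge0 ?ler0n// prodr_ge0// => i _; rewrite exprn_ge0.
Qed.

(** The multinomial coefficient enters as c^2 / c = c, so the second moment of the likelihood ratio
    is itself a multinomial sum. *)
Lemma multinom_pmf_chi2 (R : realType) (n k : nat) (P Q : 'I_k -> R)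
    (N : {ffun 'I_k -> 'I_n.+1}) :
  multinom_pmf (fun i => Q i ^+ 2 / P i) N = multinom_pmf Q N ^+ 2 / multinom_pmf P N.
Proof.
rewrite /multinom_pmf /=; case: ifP => [_|_]; last by rewrite expr0n mul0r.
have -> : \prod_(i < k) (Q i ^+ 2 / P i) ^+ N i
    = (\prod_(i < k) Q i ^+ N i) ^+ 2 / \prod_(i < k) P i ^+ N i.
  by rewrite -prodrXl -prodf_div; apply: eq_bigr => i _; rewrite expr_div_n exprAC.
set c := n`!%:R / _.
have c_neq0 : c != 0.
  rewrite mulf_neq0 ?invr_neq0// pnatr_eq0 -lt0n ?fact_gt0//.
  by apply: prodn_gt0 => i; exact: fact_gt0.
set q := \prod_(i < k) Q i ^+ N i; set p := \prod_(i < k) P i ^+ N i.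
by rewrite exprMn invfM [RHS]mulrACA [c ^+ 2]expr2 mulfK.
Qed.

(* Termwise AM-GM, in a form valid even when theta phi P = theta phi Q.  Summing
   over N, the D-terms on the right add up to D ^+ 2 because E is one plus the
   second moment of the likelihood ratio: they absorb half of the left side. *)
Lemma two_point_risk (R : realType) (n k : nat) (phi : R -> R)
    (est : {ffun 'I_k -> 'I_n.+1} -> R) (P Q : 'I_k -> R) (r : R) :
  prob_vec P -> prob_vec Q -> (forall i, 0 < P i) ->
  risk phi est P <= r -> risk phi est Q <= r ->
  (theta phi P - theta phi Q) ^+ 2
    <= 2 * (1 + (\sum_(i < k) Q i ^+ 2 / P i) ^+ n) * r.
Proof.
move=> [P_ge0 _] [Q_ge0 Q1] P_gt0 riskP riskQ.
set D := theta phi P - theta phi Q; set E := 1 + _.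
have E_gt0 : 0 < E.
  rewrite ltr_wpDr// exprn_ge0// sumr_ge0// => i _.
  by rewrite divr_ge0 ?sqr_ge0.
have termwise (N : {ffun 'I_k -> 'I_n.+1}) :
    2 * D ^+ 2 * multinom_pmf Q N
    <= E * (multinom_pmf Q N * (est N - theta phi Q) ^+ 2
            + multinom_pmf P N * (est N - theta phi P) ^+ 2)
       + D ^+ 2 / E * (multinom_pmf Q N + multinom_pmf (fun i => Q i ^+ 2 / P i) N).
  rewrite multinom_pmf_chi2.
  have : 0 <= multinom_pmf P N by apply: multinom_pmf_ge0.
  (* [P] has full support, so its weight vanishes only on histograms of total other than [n], where
     that of [Q] vanishes too. *)
  have : multinom_pmf P N = 0 -> multinom_pmf Q N = 0.
    rewrite /multinom_pmf; case: ifP => // _ /eqP.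
    rewrite gt_eqF// mulr_gt0 ?divr_gt0 ?ltr0n ?fact_gt0//.
      by apply: prodn_gt0 => i; exact: fact_gt0.
    by rewrite prodr_gt0// => i _; rewrite exprn_gt0.
  have := multinom_pmf_ge0 R n k Q N Q_ge0.
  move: (multinom_pmf P N) (multinom_pmf Q N) => p q q_ge0 pq0.
  rewrite le_eqVlt => /orP[/eqP p0|p_gt0].
    by rewrite pq0 -p0// !(expr0n, mul0r, mulr0, addr0).
  set x := est N - theta phi Q; set y := est N - theta phi P.
  have -> : D = x - y by rewrite /D /x /y; ring.
  rewrite -subr_ge0.
  (* The gap between the two sides is a sum of two squares with nonnegative weights. *)
  have -> : E * (q * x ^+ 2 + p * y ^+ 2) + (x - y) ^+ 2 / E * (q + q ^+ 2 / p)
       - 2 * (x - y) ^+ 2 * q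
     = (E * x - (x - y)) ^+ 2 * q / E + (E * p * y + (x - y) * q) ^+ 2 / (E * p).
    by field; rewrite !gt_eqF.
  have [E_ge0 p_ge0] := (ltW E_gt0, ltW p_gt0).
  apply: addr_ge0; apply: divr_ge0 => //; last exact: mulr_ge0.
    by apply: mulr_ge0 => //; exact: sqr_ge0.
  exact: sqr_ge0.
have := ler_sum (index_enum _) (fun N (_ : xpredT N) => termwise N).
rewrite -mulr_sumr big_split -!mulr_sumr !big_split /= !sum_multinom_pmf Q1 expr1n -/E.
rewrite divfK ?gt_eqF// mulr1.
have : E * (risk phi est Q + risk phi est P) <= E * (r + r).
  by rewrite ler_pM2l// lerD.
rewrite /risk; lra.
Qed.

(** * Size of the first derivative near 0 and near 1 *)

Lemma powR_antimono (R : realType) (r x y : R) :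
  r <= 0 -> 0 < x -> x <= y -> y `^ r <= x `^ r.
Proof.
move=> r_le0 x_gt0 lexy; have y_gt0 := lt_le_trans x_gt0 lexy.
rewrite -[r]opprK !(powRN _ (- r)) lef_pV2 ?posrE ?powR_gt0//.
by apply: ge0_ler_powR; rewrite ?nnegrE ?oppr_ge0 // ltW.
Qed.

(** Around an interior point, small increments stay in (0, 1], so the derivative relative to (0, 1]
    is the ordinary one. *)
Lemma is_derive_on01 (R : realType) (f : R -> R) (x l : R) :
  0 < x < 1 -> has_deriv_on01 f x l -> is_derive x 1 f l.
Proof.
move=> /andP[x_gt0 x_lt1] dfx.
suff cvg_f : (fun h : R => h^-1 *: ((f \o shift x) (h *: (1 : R)) - f x)) @ 0^' --> l.
  by apply: DeriveDef; [apply/cvg_ex; exists l | apply: cvg_lim].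
apply/cvgrPdist_lt => e e_gt0.
have [d [d_gt0 df]] := dfx _ e_gt0.
near=> h.
have h_neq0 : h != 0 by near: h; exact: nbhs_dnbhs_neq.
have h_small : `|h| < Num.min d (Num.min x (1 - x)).
  near: h; apply: dnbhs0_lt.
  by rewrite !lt_min d_gt0 x_gt0 subr_gt0.
move: h_small; rewrite !lt_min => /and3P[hd hx h1x].
have := df (h + x); rewrite addrK.
rewrite /= distrC [h *: _]mulr1 [h^-1 *: _]mulrC; apply => //.
  move: hx h1x; rewrite !ltr_norml; lra.
by rewrite -subr_eq0 addrK.
Unshelve. all: by end_near. Qed.

Lemma continuous_on01 (R : realType) (f : R -> R) (x : R) :
  0 < x < 1 -> cont_on01 f x -> {for x, continuous f}.
Proof.
move=> /andP[x_gt0 x_lt1] cfx; apply/cvgrPdist_lt => e e_gt0.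
have [d [d_gt0 cf]] := cfx _ e_gt0.
near=> q.
rewrite distrC; apply: cf.
  apply/andP; split; last apply: ltW; near: q; [exact: lt_nbhsr|exact: lt_nbhsl].
rewrite distrC; near: q; exact: cvgr_dist_lt.
Unshelve. all: by end_near. Qed.

(** The condition [b < 1] keeps the segment away from 1, where the derivative is only one-sided. *)
Lemma MVT_on01 (R : realType) (f df : R -> R) (a b : R) :
  (forall p : R, 0 < p <= 1 -> has_deriv_on01 f p (df p)) ->
  0 < a -> a <= b -> b < 1 ->
  exists2 c, a <= c <= b & f b - f a = df c * (b - a).
Proof.
move=> dfE a_gt0 leab b_lt1.
have is_df c : a <= c <= b -> is_derive c 1 f (df c).
  move=> /andP[leac lecb].
  have c01 : 0 < c < 1 by rewrite (lt_le_trans a_gt0 leac) (le_lt_trans lecb b_lt1).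
  by apply: is_derive_on01 => //; apply: dfE; case/andP: c01 => -> /ltW ->.
have [||c cab fE] := @MVT_segment R f df a b leab.
- by move=> c; rewrite in_itv /= => /andP[/ltW ? /ltW ?]; apply: is_df; apply/andP.
- by apply: derivable_within_continuous => c; rewrite in_itv /= => /is_df[].
- by exists c => //; rewrite in_itv in cab.
Qed.

(** A change of sign between [p] and [b] would force a zero by the intermediate value theorem; [s]
    is the sign of [f b]. *)
Lemma constant_sign (R : realType) (f : R -> R) (b : R) :
  (forall p : R, 0 < p <= b -> {for p, continuous f}) ->
  (forall p : R, 0 < p <= b -> f p != 0) ->
  exists2 s : R, `|s| = 1 & forall p : R, 0 < p <= b -> `|f p| = s * f p.
Proof.
move=> cf f_neq0.
have [b_le0|b_gt0] := leP b 0.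
  exists 1; first exact: normr1.
  by move=> p /andP[/lt_le_trans h /h]; rewrite ltNge b_le0.
have fb0 : f b != 0 by apply: f_neq0; rewrite b_gt0 lexx.
exists (Num.sg (f b)); first by rewrite normr_sg fb0.
move=> p /andP[p_gt0 lepb].
have fp0 : f p != 0 by apply: f_neq0; rewrite p_gt0 lepb.
rewrite normrEsg; congr (_ * _); apply/eqP/negPn/negP => sg_neq.
have [c] : exists2 c, c \in `[p, b] & f c = 0.
  apply: IVT => //.
    apply: continuous_in_subspaceT => c; rewrite inE /= in_itv /= => /andP[lepc lecb].
    by apply: cf; rewrite lecb (lt_le_trans p_gt0 lepc).
  move: sg_neq fp0 fb0; rewrite ge_min le_max.
  case: (ltrgt0P (f p)) => [fp|fp|fp]; case: (ltrgt0P (f b)) => [fb|fb|fb] //=;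
    by rewrite ?(gtr0_sg fp) ?(ltr0_sg fp) ?(gtr0_sg fb) ?(ltr0_sg fb) ?eqxx ?orbT.
rewrite in_itv /= => /andP[lepc lecb] fc0.
by have := f_neq0 c; rewrite lecb (lt_le_trans p_gt0 lepc) fc0 eqxx => /(_ isT).
Qed.

(** Near 0 the power absorbs [c], so [phi2] has a constant sign [s]. Then s phi1(p) + K p^(alpha -
    1) is nondecreasing, and comparison with its value at [b] bounds [phi1] from below. *)
Lemma deriv_blowup (R : realType) (alpha L c : R) (phi1 phi2 : R -> R) :
  alpha < 1 -> 0 < L ->
  (forall p : R, 0 < p <= 1 -> has_deriv_on01 phi1 p (phi2 p)) ->
  (forall p : R, 0 < p <= 1 -> cont_on01 phi2 p) ->
  (forall p : R, 0 < p <= 1 -> L * p `^ (alpha - 2) + c <= `|phi2 p|) ->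
  exists K A b : R, [/\ 0 < K, 0 < b <= 4^-1 &
    forall p : R, 0 < p <= b -> K * p `^ (alpha - 1) - A <= `|phi1 p|].
Proof.
move=> alpha_lt1 L_gt0 phi1' cphi2 phi2_ge.
(* For p <= b the second bound gives (L/2) p^(alpha - 2) >= (L/2) / p >= |c| + 1; the cap 1/4 later
   keeps the heavy atom in [3/4, 1). *)
set b := Num.min 4^-1 (L / (2 * (`|c| + 1))).
have c1_gt0 : 0 < `|c| + 1 by rewrite ltr_wpDl.
have b_gt0 : 0 < b by rewrite lt_min invr_gt0 ltr0n divr_gt0// mulr_gt0.
have b_le : b <= 4^-1 by rewrite ge_min lexx.
have b01 (p : R) : 0 < p <= b -> 0 < p < 1 by move=> /andP[? ?]; lra.
have b01' (p : R) : 0 < p <= b -> 0 < p <= 1 by move=> /andP[? ?]; lra.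
have phi2_ge' (p : R) : 0 < p <= b -> L / 2 * p `^ (alpha - 2) <= `|phi2 p|.
  move=> pb; apply: le_trans (phi2_ge p (b01' p pb)).
  have pV : p^-1 <= p `^ (alpha - 2).
    rewrite -powR_inv1; last by case/andP: pb => /ltW.
    by apply: ger_powR; [exact: b01'|lra].
  have : `|c| + 1 <= L / 2 * p^-1.
    case/andP: pb => p_gt0; rewrite le_min => /andP[_].
    rewrite ler_pdivlMr ?mulr_gt0// => ple.
    by rewrite ler_pdivlMr//; lra.
  have : L / 2 * p^-1 <= L / 2 * p `^ (alpha - 2) by rewrite ler_pM2l// divr_gt0.
  have := ler_norm (- c); rewrite normrN; lra.
have [s s1 phi2_s] : exists2 s : R, `|s| = 1 &
    forall p : R, 0 < p <= b -> `|phi2 p| = s * phi2 p.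
  apply: constant_sign => p pb.
    by apply: continuous_on01; [exact: b01|exact/cphi2/b01'].
  rewrite -normr_gt0; apply: lt_le_trans (phi2_ge' p pb).
  by rewrite mulr_gt0 ?divr_gt0// powR_gt0//; case/andP: pb.
(* Chosen so that K p^(alpha - 1) has derivative -(L/2) p^(alpha - 2), which the lower bound on
   |phi2| compensates. *)
set K := L / 2 / (1 - alpha).
have K_gt0 : 0 < K by rewrite !divr_gt0// subr_gt0.
pose f (p : R) := s * phi1 p + K * p `^ (alpha - 1).
pose df (p : R) := s * phi2 p + K * ((alpha - 1) * p `^ (alpha - 1 - 1)).
have is_df (p : R) : 0 < p <= b -> is_derive p 1 f (df p).
  move=> pb.
  have dphi := is_derive_on01 _ _ _ _ (b01 p pb) (phi1' p (b01' p pb)).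
  have dpow := is_derive1_powR (alpha - 1) (proj1 (andP pb)).
  exact: is_deriveD (is_deriveZ s dphi) (is_deriveZ K dpow).
exists K, (f b), b; split => //; first by rewrite b_gt0.
move=> p /andP[p_gt0 lepb].
have pq (q : R) : p <= q <= b -> 0 < q <= b.
  by move=> /andP[/(lt_le_trans p_gt0) -> ->].
have [||q /[!in_itv]/= pqb fE] := @MVT_segment R f df p b lepb.
- by move=> q; rewrite in_itv /= => /andP[/ltW ? /ltW ?]; apply/is_df/pq/andP.
- by apply: derivable_within_continuous => q; rewrite in_itv /= => /pq/is_df[].
have : 0 <= f b - f p.
  rewrite fE mulr_ge0 ?subr_ge0//.
  have := phi2_ge' q (pq q pqb); rewrite /df -phi2_s; last exact: pq.
  have -> : alpha - 1 - 1 = alpha - 2 by lra.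
  have -> : K * ((alpha - 1) * q `^ (alpha - 2)) = - (L / 2 * q `^ (alpha - 2)).
    by rewrite /K; field; lra.
  lra.
have : - (s * phi1 p) <= `|phi1 p|.
  by rewrite -[`|phi1 p|]mul1r -s1 -normrM -normrN ler_norm.
rewrite {2}/f; lra.
Qed.

(** On [3/4, 1) the power p^(alpha - 2) is at most its value at 3/4, so [phi2] is bounded there and
    the mean value theorem from 3/4 bounds [phi1]. *)
Lemma deriv_bounded (R : realType) (alpha L c : R) (phi1 phi2 : R -> R) :
  alpha <= 2 -> 0 <= L ->
  (forall p : R, 0 < p <= 1 -> has_deriv_on01 phi1 p (phi2 p)) ->
  (forall p : R, 0 < p <= 1 -> `|phi2 p| <= L * p `^ (alpha - 2) + c) ->
  exists M : R, forall p : R, 3 / 4 <= p < 1 -> `|phi1 p| <= M.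
Proof.
move=> alpha_le2 L_ge0 phi1' phi2_le.
set B := L * (3 / 4) `^ (alpha - 2) + c.
exists (`|phi1 (3 / 4)| + B) => p /andP[p_ge p_lt1].
have p0_gt0 : 0 < 3 / 4 :> R by lra.
have [q /andP[q_ge leqp] phi1E] := MVT_on01 _ _ _ _ _ phi1' p0_gt0 p_ge p_lt1.
have q_gt0 : 0 < q by lra.
have q_le1 : q <= 1 by lra.
have phi2q : `|phi2 q| <= B.
  apply: le_trans (phi2_le q _) _; first by rewrite q_gt0.
  by rewrite lerD2r ler_wpM2l// powR_antimono//; lra.
have -> : phi1 p = phi1 (3 / 4) + phi2 q * (p - 3 / 4) by rewrite -phi1E; ring.
apply: le_trans (ler_normD _ _) _; rewrite lerD2l normrM (ger0_norm (_ : 0 <= p - 3 / 4)); last lra.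
apply: le_trans phi2q; rewrite ler_piMr//; lra.
Qed.

(** * The two-point family: chi-square distance and separation *)

(** The light symbols have mass of order 1/m, where the derivative of [phi] is large. *)
Definition heavy_atom {R : realType} (m : nat) (a : R) : 'I_m.+1 -> R :=
  fun i => if i == ord0 then 1 - a else a / m%:R.

(** A function [F] of two entries lets one formula serve the total mass, [theta] and the chi-square
    sum. *)
Lemma sum_heavy_atom {R : realType} (m : nat) (a b : R) (F : R -> R -> R) :
  \sum_(i < m.+1) F (heavy_atom m a i) (heavy_atom m b i)
    = F (1 - a) (1 - b) + m%:R * F (a / m%:R) (b / m%:R).
Proof.
rewrite big_ord_recl /heavy_atom eqxx; congr (_ + _).
under eq_bigr do rewrite eq_sym (negbTE (neq_lift _ _)).
by rewrite sumr_const card_ord mulr_natl.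
Qed.

Lemma heavy_atom_prob (R : realType) (m : nat) (a : R) :
  (0 < m)%N -> 0 <= a <= 1 -> prob_vec (heavy_atom m a).
Proof.
move=> m_gt0 /andP[a_ge0 a_le1]; split.
  move=> i; rewrite /heavy_atom; case: ifP => _; first by rewrite subr_ge0.
  by rewrite divr_ge0.
rewrite (sum_heavy_atom m a a (fun x _ => x)) mulrC divfK ?subrK//.
by rewrite pnatr_eq0 -lt0n.
Qed.

(** The sum equals 1 + (1/n) a / (1 - a), and a <= 1/2 makes this at most 1 + 1/n <= exp(1/n). *)
Lemma heavy_atom_chi2 (R : realType) (m n : nat) (a : R) :
  (0 < m)%N -> (0 < n)%N -> 0 < a <= 2^-1 ->
  (\sum_(i < m.+1) heavy_atom m (a + a / Num.sqrt n%:R) i ^+ 2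
                   / heavy_atom m a i) ^+ n <= expR 1.
Proof.
move=> m_gt0 n_gt0 /andP[a_gt0 a_le]; set h := a / _.
rewrite (sum_heavy_atom m (a + h) a (fun x y => x ^+ 2 / y)).
have m_neq0 : m%:R != 0 :> R by rewrite pnatr_eq0 -lt0n.
have n0 : 0 < n%:R :> R by rewrite ltr0n.
have n_neq0 : n%:R != 0 :> R by rewrite gt_eqF.
have a_neq0 : a != 0 by rewrite gt_eqF.
have a1_neq0 : 1 - a != 0 by rewrite gt_eqF//; lra.
have -> : (1 - (a + h)) ^+ 2 / (1 - a) + m%:R * (((a + h) / m%:R) ^+ 2 / (a / m%:R))
    = 1 + h ^+ 2 / (a * (1 - a)).
  by field; rewrite ?m_neq0 ?a_neq0 ?a1_neq0.
have -> : h ^+ 2 / (a * (1 - a)) = n%:R^-1 * (a / (1 - a)).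
  rewrite /h expr_div_n sqr_sqrtr ?ler0n//.
  by field; rewrite ?n_neq0 ?a_neq0 ?a1_neq0.
have a1 : 0 <= a / (1 - a) <= 1.
  by rewrite divr_ge0 ?ler_pdivrMr ?mul1r//; lra.
have -> : expR 1 = expR n%:R^-1 ^+ n :> R by rewrite -expRM_natr mulVf// gt_eqF.
have n1 : 0 <= n%:R^-1 :> R by rewrite invr_ge0 ltW.
apply: lerXn2r; rewrite ?nnegrE ?expR_ge0//.
  by rewrite addr_ge0// mulr_ge0//; lra.
apply: le_trans (expR_ge1Dx _); rewrite lerD2l ler_piMr//; lra.
Qed.

(** The mean value theorem is applied separately to the heavy atom and to a light one, giving points
    [x] near 1 and [y] near 0 and the difference (phi1(x) - phi1(y)) h. The choice of [a] does not
    depend on [m]. *)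
Lemma theta_heavy_atom_gap (R : realType) (alpha K A b M : R) (phi phi1 : R -> R) :
  alpha < 1 -> 0 < K -> 0 < b <= 4^-1 ->
  (forall p : R, 0 < p <= 1 -> has_deriv_on01 phi p (phi1 p)) ->
  (forall p : R, 0 < p <= b -> K * p `^ (alpha - 1) - A <= `|phi1 p|) ->
  (forall p : R, 3 / 4 <= p < 1 -> `|phi1 p| <= M) ->
  exists a : R, 0 < a <= 4^-1 /\
    forall (m : nat) (h : R), (0 < m)%N -> 0 <= h <= a ->
      K / 2 * m%:R `^ (1 - alpha) * h
        <= `|theta phi (heavy_atom m a) - theta phi (heavy_atom m (a + h))|.
Proof.
move=> alpha_lt1 K_gt0 /andP[b_gt0 b_le] dphi phi1_ge phi1_le.
have alpha1 : alpha - 1 != 0 by rewrite lt_eqF// subr_lt0.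
(* Threshold with (K/2) T >= A + M; adding 1 makes [T] positive, so that y <= T^(1 / (alpha - 1))
   gives y^(alpha - 1) >= T. *)
pose T := `|A + M| / (K / 2) + 1.
have T_gt0 : 0 < T by rewrite ltr_wpDl// !divr_ge0// ltW.
pose a0 := Num.min b (T `^ (alpha - 1)^-1).
have a0_gt0 : 0 < a0 by rewrite lt_min b_gt0 powR_gt0.
have a0_le_b : a0 <= b by rewrite ge_min lexx.
(* Halving leaves room for the shift: a + h <= a0 whenever h <= a. *)
exists (a0 / 2); split=> [|m h m_gt0 /andP[h_ge0 h_le]]; first by apply/andP; lra.
have m0 : 0 < m%:R :> R by rewrite ltr0n.
have m1 : 1 <= m%:R :> R by rewrite ler1n.
have m_neq0 : m%:R != 0 :> R by rewrite gt_eqF.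
have [x /andP[x_ge x_le] xE] := MVT_on01 R phi phi1 (1 - (a0 / 2 + h)) (1 - a0 / 2)
  dphi ltac:(lra) ltac:(lra) ltac:(lra).
have y1_gt0 : 0 < a0 / 2 / m%:R by rewrite !divr_gt0.
have y2_le : (a0 / 2 + h) / m%:R <= a0 / m%:R by rewrite ler_pM2r ?invr_gt0//; lra.
have am_le : a0 / m%:R <= a0 by rewrite ler_pdivrMr// ler_peMr// ltW.
have y12 : a0 / 2 / m%:R <= (a0 / 2 + h) / m%:R by rewrite ler_pM2r ?invr_gt0//; lra.
have [y /andP[y_ge y_le] yE] := MVT_on01 R phi phi1 (a0 / 2 / m%:R) ((a0 / 2 + h) / m%:R)
  dphi y1_gt0 y12 ltac:(lra).
have thetaE c : theta phi (heavy_atom m c) = phi (1 - c) + m%:R * phi (c / m%:R).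
  exact: (sum_heavy_atom m c c (fun x _ => phi x)).
have -> : theta phi (heavy_atom m (a0 / 2)) - theta phi (heavy_atom m (a0 / 2 + h))
    = (phi1 x - phi1 y) * h.
  have -> : (phi1 x - phi1 y) * h = phi1 x * (1 - a0 / 2 - (1 - (a0 / 2 + h)))
       - m%:R * (phi1 y * ((a0 / 2 + h) / m%:R - a0 / 2 / m%:R)) by field.
  by rewrite -xE -yE !thetaE; ring.
rewrite normrM (ger0_norm h_ge0) ler_wpM2r//.
have y_gt0 : 0 < y by lra.
have phi1x : `|phi1 x| <= M by apply: phi1_le; lra.
have phi1y : K * y `^ (alpha - 1) - A <= `|phi1 y| by apply: phi1_ge; lra.
have yT : A + M <= K / 2 * y `^ (alpha - 1).
  have : T <= y `^ (alpha - 1).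
    have -> : T = (T `^ (alpha - 1)^-1) `^ (alpha - 1).
      by rewrite -powRrM mulVf// powRr1// ltW.
    apply: powR_antimono => //; first lra.
    apply: (@le_trans _ _ a0); first lra.
    by rewrite ge_min lexx orbT.
  rewrite -(ler_pM2l (_ : 0 < K / 2)) ?divr_gt0//.
  have -> : K / 2 * T = `|A + M| + K / 2 by rewrite /T; field; rewrite gt_eqF.
  have := ler_norm (A + M); lra.
(* Since y <= 1/m and the exponent alpha - 1 is negative. *)
have ym : m%:R `^ (1 - alpha) <= y `^ (alpha - 1).
  have -> : m%:R `^ (1 - alpha) = m%:R^-1 `^ (alpha - 1) :> R.
    by rewrite -powR_inv1 ?ler0n// -powRrM; congr (_ `^ _); ring.
  apply: powR_antimono => //; first lra.
  apply: le_trans y_le (le_trans y2_le _).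
  by rewrite ler_piMl ?invr_ge0 ?ler0n//; lra.
(* Reverse triangle inequality: half of K y^(alpha - 1) absorbs A + M, the other half remains. *)
have := ler_normB (phi1 x) (phi1 x - phi1 y).
rewrite opprB addrC subrK.
have : K / 2 * m%:R `^ (1 - alpha) <= K / 2 * y `^ (alpha - 1).
  by rewrite ler_pM2l// divr_gt0.
lra.
Qed.

(** * Assembly of the minimax lower bound *)

Theorem theorem3 (R : realType) (alpha : R) (phi : R -> R) :
  0 < alpha < 1 ->
  (forall p : R, 0 <= p <= 1 -> 0 <= phi p) ->
  (exists phi1 phi2 : R -> R,
     (forall p : R, 0 < p <= 1 -> has_deriv_on01 phi p (phi1 p)) /\
     (forall p : R, 0 < p <= 1 -> has_deriv_on01 phi1 p (phi2 p)) /\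
     (forall p : R, 0 < p <= 1 -> cont_on01 phi2 p) /\
     (exists W c c' : R, 0 < W /\
        forall p : R, 0 < p <= 1 ->
          (2 - alpha) * W * p `^ (alpha - 2) + c' <= `|phi2 p| <=
          (2 - alpha) * W * p `^ (alpha - 2) + c)) ->
  exists C : R, 0 < C /\
    forall n k : nat, (0 < n)%N -> (3 <= k)%N ->
      ((C * (k%:R `^ (2 - 2 * alpha)) / n%:R)%:E <= minimax_risk n k phi)%E.
Proof.
move=> /andP[alpha_gt0 alpha_lt1] _.
move=> [phi1 [phi2 [dphi [dphi1 [cphi2 [W [c [c' [W_gt0 phi2_bounds]]]]]]]]].
have L_gt0 : 0 < (2 - alpha) * W by rewrite mulr_gt0//; lra.
have [K [A [b [K_gt0 b_gt0 phi1_ge]]]] :=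
  deriv_blowup R alpha _ c' phi1 phi2 alpha_lt1 L_gt0 dphi1 cphi2
    (fun p hp => proj1 (andP (phi2_bounds p hp))).
have [M phi1_le] := deriv_bounded R alpha _ c phi1 phi2 ltac:(lra) (ltW L_gt0) dphi1
  (fun p hp => proj2 (andP (phi2_bounds p hp))).
have [a [/andP[a_gt0 a_le] gap]] := theta_heavy_atom_gap R alpha K A b M phi phi1
  alpha_lt1 K_gt0 b_gt0 dphi phi1_ge phi1_le.
have e_gt0 : 0 < expR 1 :> R := expR_gt0 1.
(* The separation is at least (K/2)(a/2) k^(1 - alpha) / sqrt n, the last 1/2 paying for replacing m
   = k - 1 by k; the denominator comes from the two-point inequality with second moment at most
   e. *)
exists ((K / 2 * a / 2) ^+ 2 / (2 * (1 + expR 1))); split.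
  by rewrite divr_gt0 ?exprn_gt0 ?mulr_gt0 ?divr_gt0// addr_gt0.
move=> n [//|m] n_gt0 m_ge2.
have m_gt0 : (0 < m)%N by rewrite -ltnS ltnW.
apply: le_ereal_inf_tmp => _ [est _ <-].
pose h : R := a / Num.sqrt n%:R.
have sqrtn_ge1 : 1 <= Num.sqrt n%:R :> R by rewrite -[leLHS]sqrtr1 ler_sqrt ?ler1n ?ltr0n.
have h_ge0 : 0 <= h by rewrite divr_ge0 ?sqrtr_ge0// ltW.
have h_le : h <= a by rewrite ler_pdivrMr ?(lt_le_trans ltr01)// ler_peMr// ltW.
pose P := heavy_atom m a; pose Q := heavy_atom m (a + h).
have Pprob : prob_vec P by apply: heavy_atom_prob => //; lra.
have Qprob : prob_vec Q by apply: heavy_atom_prob => //; lra.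
have P_gt0 i : 0 < P i.
  by rewrite /P /heavy_atom; case: ifP => _; [lra|rewrite divr_gt0// ltr0n].
pose r := Num.max (risk phi est P) (risk phi est Q).
have riskP : risk phi est P <= r by rewrite le_max lexx.
have riskQ : risk phi est Q <= r by rewrite le_max lexx orbT.
(* The larger of the two risks is one of the values under the supremum. *)
apply: (@le_trans _ _ r%:E); last first.
  apply: ereal_sup_ubound; rewrite /r.
  by case: (leP (risk phi est P) (risk phi est Q)) => _; [exists Q | exists P].
have r_ge0 : 0 <= r.
  apply: le_trans riskP; apply: sumr_ge0 => N _.
  rewrite mulr_ge0 ?sqr_ge0// multinom_pmf_ge0//.
  by case: Pprob.
have le_r : (theta phi P - theta phi Q) ^+ 2 <= 2 * (1 + expR 1) * r.
  apply: le_trans (two_point_risk R n m.+1 phi est P Q r Pprob Qprob P_gt0 riskP riskQ) _.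
  rewrite ler_wpM2r// ler_pM2l// lerD2l heavy_atom_chi2//; lra.
(* From m + 1 <= 2m and 2^(1 - alpha) <= 2. *)
have k_le : m.+1%:R `^ (1 - alpha) / 2 <= m%:R `^ (1 - alpha) :> R.
  rewrite ler_pdivrMr//.
  have le2m : m.+1%:R <= m%:R * 2 :> R by rewrite -natrM ler_nat muln2 -addnn -add1n leq_add2r.
  apply: (@le_trans _ _ ((m%:R * 2) `^ (1 - alpha))).
    by apply: ge0_ler_powR; rewrite ?nnegrE ?mulr_ge0 ?ler0n//; lra.
  rewrite powRM ?ler0n// ler_wpM2l ?powR_ge0//.
  rewrite -[leRHS]powRr1//; apply: ler_powR; lra.
have gap_m := gap m h m_gt0 (introT andP (conj h_ge0 h_le)).
have low : K / 2 * a / 2 * m.+1%:R `^ (1 - alpha) / Num.sqrt n%:R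
    <= `|theta phi P - theta phi Q|.
  apply: le_trans gap_m.
  have -> : K / 2 * a / 2 * m.+1%:R `^ (1 - alpha) / Num.sqrt n%:R
     = K / 2 * (m.+1%:R `^ (1 - alpha) / 2) * h by rewrite /h; ring.
  by rewrite ler_wpM2r// ler_wpM2l// divr_ge0// ltW.
have -> : 2 - 2 * alpha = (1 - alpha) * 2%:R by ring.
rewrite lee_fin powRrM powR_mulrn ?powR_ge0//.
rewrite -mulrA mulrAC.
rewrite ler_pdivrMr ?mulr_gt0 ?addr_gt0// [r * _]mulrC; apply: le_trans le_r.
rewrite -[leRHS]real_normK ?num_real//.
have -> : (K / 2 * a / 2) ^+ 2 * (m.+1%:R `^ (1 - alpha) ^+ 2 / n%:R)
    = (K / 2 * a / 2 * m.+1%:R `^ (1 - alpha) / Num.sqrt n%:R) ^+ 2.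
  by rewrite -[in LHS](@sqr_sqrtr _ n%:R) ?ler0n// -expr_div_n -exprMn !mulrA.
apply: lerXn2r => //; rewrite nnegrE ?normr_ge0//.
by rewrite !(mulr_ge0, divr_ge0, powR_ge0, sqrtr_ge0)// ltW.
Qed.
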